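(* There is an absolute constant $K$ such that for every $k\ge1$ and every $n\ge1$, \[ \operatorname{Ex}(I_k\otimes H,n)\le 2(k-1)\,n\,\alpha(n)+Kkn, \] where $I_k$ is the $k\times k$ identity matrix.
   Context: All matrices are 0--1 matrices, indexed with row 1 at the top. For a $k\times l$ matrix $P$ and an $n\times m$ matrix $A$, $P$ is contained in $A$ if there are rows $r_1<\dots<r_k$ and columns $c_1<\dots<c_l$ of $A$ with $P(i,j)=1\Rightarrow A(r_i,c_j)=1$; otherwise $A$ avoids $P$. $\operatorname{Ex}(P,n,m)$ is the maximum number of 1s in an $n\times m$ 0--1 matrix avoiding $P$, and $\operatorname{Ex}(P,n)=\operatorname{Ex}(P,n,n)$. $H$ is the $2\times 3$ matrix with top row $(0,1,0)$ and bottom row $(1,0,1)$. For a $k\times l$ matrix $P$, $P\otimes H$ is the $2k\times 3l$ matrix partitioned into $2\times3$ blocks, block $(i,j)$ being $H$ if $P(i,j)=1$ and zero otherwise. Ackermann function: $a_{1,j}=2^j$ ($j\ge1$); $a_{i,1}=2$ ($i\ge2$); $a_{i,j}=w\cdot a_{i-1,w}$ with $w=a_{i,j-1}$ ($i,j\ge2$). $\alpha(n,m)=\min\{i\ge1:a_{i,j}\ge m\}$ where $j=\max\{3,\lceil n/m\rceil\}$; $\alpha(n)=\alpha(n,n)$. *)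

(* Defs.v *)
From mathcomp Require Import all_boot all_order all_algebra.
From mathcomp Require Import mxtens.

Set Implicit Arguments.
Unset Strict Implicit.
Unset Printing Implicit Defensive.

(* 0-1 matrices are matrices over bool.  MathComp's ring structure on bool is
   the field with two elements, so that a product of entries is their
   conjunction, 1%:M is the identity matrix, and the Kronecker product *t is
   the block substitution P (x) Q with block (i, j) equal to P i j * Q. *)

Definition strict_incr k n (f : {ffun 'I_k -> 'I_n}) : bool :=
  [forall i : 'I_k, forall i' : 'I_k, (i < i') ==> (f i < f i')].

Definition contains k l n m (P : 'M[bool]_(k, l)) (A : 'M[bool]_(n, m)) : bool :=
  [exists r : {ffun 'I_k -> 'I_n}, exists c : {ffun 'I_l -> 'I_m},
    [&& strict_incr r, strict_incr c &
        [forall i : 'I_k, forall j : 'I_l, P i j ==> A (r i) (c j)]]].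

Definition weight n m (A : 'M[bool]_(n, m)) : nat :=
  #|[set ij : 'I_n * 'I_m | A ij.1 ij.2]|.

(* The value is 0 when no n x m matrix avoids P, which is only possible if P
   is a zero matrix. *)
Definition Ex2 k l (P : 'M[bool]_(k, l)) (n m : nat) : nat :=
  \max_(A : 'M[bool]_(n, m) | ~~ contains P A) weight A.

Definition Ex k l (P : 'M[bool]_(k, l)) (n : nat) : nat := Ex2 P n n.

Definition H : 'M[bool]_(2, 3) :=
  \matrix_(i, j) nth false (nth [::] [:: [:: false; true; false];
                                         [:: true; false; true]] i) j.

(* The function is meant for i, j >= 1; the values at i = 0 or j = 0 are
   irrelevant. *)
Fixpoint ack (i : nat) : nat -> nat :=
  if i is i'.+1 then
    if i' is 0 then fun j => 2 ^ j
    else fix row (j : nat) : nat :=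
      if j is j'.+1 then
        if j' is 0 then 2 else let w := row j' in w * ack i' w
      else 0
  else fun _ => 0.

Lemma ack1 j : ack 1 j = 2 ^ j.
Proof. by []. Qed.

Lemma ackS1 i : ack i.+2 1 = 2.
Proof. by []. Qed.

Lemma ackSS i j : ack i.+2 j.+2 = ack i.+2 j.+1 * ack i.+1 (ack i.+2 j.+1).
Proof. by []. Qed.

Lemma ack_gt i j : j.+1 < ack i.+1 j.+1.
Proof.
elim: i j => [|i IHi] j; first by rewrite ack1 ltn_expl.
elim: j => [|j IHj] //; rewrite ackSS.
move: IHj; set w := ack i.+2 j.+1 => ltjw.
have w_gt1 : 1 < w by apply: leq_ltn_trans ltjw.
have := IHi w.-1; rewrite prednK ?(ltnW w_gt1) // => ltw.
apply: leq_ltn_trans ltjw _; apply: leq_trans ltw _.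
by rewrite leq_pmull // ltnW.
Qed.

Lemma ack_gt0 i j : 0 < ack i.+1 j.+1.
Proof. exact: leq_ltn_trans (ack_gt i j). Qed.

Lemma leq_ackS i j : ack i.+1 j.+1 <= ack i.+1 j.+2.
Proof.
case: i => [|i]; first by rewrite !ack1 leq_exp2l.
rewrite ackSS leq_pmulr //; have := ack_gt0 i (ack i.+2 j.+1).-1.
by rewrite prednK // ack_gt0.
Qed.

Lemma leq_ack i j j' : j <= j' -> ack i.+1 j.+1 <= ack i.+1 j'.+1.
Proof.
move=> /subnK <-; elim: (j' - j) => // d IHd.
exact: leq_trans IHd (leq_ackS _ _).
Qed.

Lemma ack_ge i j : i < ack i.+1 j.+2.
Proof.
elim: i => [|i IHi]; first by rewrite ack1 expn_gt0.
rewrite ackSS; apply: leq_ltn_trans IHi _.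
have := ack_gt i.+1 j; set w := ack i.+2 j.+1 => ltw.
have w_gt1 : 1 < w by apply: leq_ltn_trans ltw.
have le2 : ack i.+1 j.+2 <= ack i.+1 w.
  by rewrite -(prednK (ltnW w_gt1)) leq_ack // -ltnS prednK // ltnW.
apply: leq_ltn_trans le2 _; apply: ltn_Pmull => //.
by rewrite -(prednK (ltnW w_gt1)) ack_gt0.
Qed.

(* The ceiling of n / m, for m >= 1. *)
Definition ceil_div (n m : nat) : nat := (n + m.-1) %/ m.

Lemma alpha_subproof n m :
  exists i, (0 < i) && (m <= ack i (maxn 3 (ceil_div n m))).
Proof.
exists m.+1 => /=; have : 3 <= maxn 3 (ceil_div n m) by exact: leq_maxl.
by case: (maxn _ _) => [|[|j]] // _; apply/ltnW/ack_ge.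
Qed.

Definition alpha2 (n m : nat) : nat := ex_minn (alpha_subproof n m).

Definition alpha (n : nat) : nat := alpha2 n n.

(* Main.v *)
(** A cell has level t when the part of the matrix strictly above and to the
    left of it contains I_t (x) H but not I_(t+1) (x) H.  In a matrix avoiding
    I_k (x) H only the levels 0, ..., k-1 occur.  After removing from a level
    the cells whose diagonal successor has a larger level (at most one on each
    diagonal), level 0 avoids H and is linear, while a level t >= 1 has no copy
    of H whose upper left corner has level at least t.  Because levels grow to
    the right, such a level avoids the zigzag x, y, x, y of entries in rows
    x < y and columns c0 <= c1 < c2 < c3.

    Zigzag-free matrices are bounded by the Davenport-Schinzel recursion.  Cut
    the columns into slabs.  Rows living in one slab are treated recursively.
    For the others, contract each slab to a column, dropping the first slab of
    every row; what is left is zigzag-free, and up to two entries per row and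
    two per column the entries of these rows are counted by the contraction.
    This gives (2i+2) n + 2ij(m-1) for m <= a_(i,j).  A last cut into slabs of
    width alpha(n) makes the second term linear. *)

Require Import Defs.
From mathcomp Require Import all_boot all_order all_algebra.
From mathcomp Require Import mxtens.
From mathcomp Require Import zify.

(** * Counting the entries of zigzag-free matrices *)

Definition ones (n m : nat) (A : nat -> nat -> bool) : nat :=
  \sum_(x < n) \sum_(c < m) A x c.

Definition nzrows (n m : nat) (A : nat -> nat -> bool) : nat :=
  \sum_(x < n) [exists c : 'I_m, A x c].

Definition zigzag_free (A : nat -> nat -> bool) : Prop :=
  forall x y c0 c1 c2 c3, x < y -> c0 <= c1 -> c1 < c2 -> c2 < c3 ->
    A x c0 -> A y c1 -> A x c2 -> ~~ A y c3.

(* The summand [m - 1], rather than [m], pays for the last, incomplete slab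
   in the recursion. *)
Definition zigzag_bound (p e n m : nat) : Prop :=
  forall A, zigzag_free A -> ones n m A <= p * nzrows n m A + e * (m - 1).

Lemma leq_sum_uniq (T : finType) (P : pred T) (b : bool) :
  (forall i, P i -> b) -> (forall i j, P i -> P j -> i = j) -> \sum_i P i <= b.
Proof.
move=> Pb Puniq; case: (pickP P) => [i Pi | P0]; last first.
  by rewrite big1 // => i _; rewrite P0.
rewrite (bigD1 i) //= Pi (Pb _ Pi) big1 // => j ne_ji.
by case Pj: (P j) => //; rewrite (Puniq _ _ Pj Pi) eqxx in ne_ji.
Qed.

Lemma leq_nzrows n m A : nzrows n m A <= n.
Proof.
rewrite -[leqRHS]card_ord -sum1_card; apply: leq_sum => x _.
exact: leq_b1.
Qed.

Lemma ones_trivial n m A : ones n m A <= m * nzrows n m A.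
Proof.
rewrite big_distrr /=; apply: leq_sum => x _.
case: existsP => [_ | noc].
  rewrite muln1 -[leqRHS]card_ord -sum1_card; apply: leq_sum => c _.
  exact: leq_b1.
rewrite big1 // => c _; case Axc: (A x c) => //.
by case: noc; exists c.
Qed.

(** * Slabs and their contraction *)

Lemma ltn_div w c c' : c %/ w < c' %/ w -> c < c'.
Proof. by rewrite !ltnNge; apply: contra => /leq_div2r. Qed.

Definition in_slab w m (A : nat -> nat -> bool) x s :=
  [exists c : 'I_m, A x c && (c %/ w == s)].
Definition before_slab w m (A : nat -> nat -> bool) x s :=
  [exists c : 'I_m, A x c && (c %/ w < s)].
Definition after_slab w m (A : nat -> nat -> bool) x s :=
  [exists c : 'I_m, A x c && (s < c %/ w)].
(* The first slab of a row is left out: entries of x and y inside a common slab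
   need not satisfy c0 <= c1, so keeping it could create zigzags. *)
Definition contract w m A x s := in_slab w m A x s && before_slab w m A x s.
Definition global q w m A x := [exists s : 'I_q, contract w m A x s].

(** For [s0] the entry to pick is the one in an earlier slab: its column precedes the one picked in
    [s1] even when [s0 = s1]. The other columns lie in increasing slabs. *)
Lemma zigzag_free_contract w m A :
  zigzag_free A -> zigzag_free (contract w m A).
Proof.
move=> freeA x y s0 s1 s2 s3 lt_xy le_s01 lt_s12 lt_s23.
case/andP=> _ /existsP[c0 /andP[Ac0 lt_c0]].
case/andP=> /existsP[c1 /andP[Ac1 /eqP s_c1]] _.
case/andP=> /existsP[c2 /andP[Ac2 /eqP s_c2]] _.
apply/negP; case/andP=> /existsP[c3 /andP[Ac3 /eqP s_c3]] _.
apply/idP: Ac3; apply: (freeA x y c0 c1 c2 c3) => //.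
- apply/ltnW/(@ltn_div w); rewrite s_c1; exact: leq_trans lt_c0 le_s01.
- by apply: (@ltn_div w); rewrite s_c1 s_c2.
- by apply: (@ltn_div w); rewrite s_c2 s_c3.
Qed.

Lemma big_ord_slabs q w r (F : nat -> nat) :
  \sum_(c < q * w + r) F c
    = \sum_(s < q) \sum_(c < w) F (s * w + c) + \sum_(c < r) F (q * w + c).
Proof.
rewrite big_split_ord /=; congr (_ + _).
elim: q => [|q IHq]; first by rewrite !big_ord0.
rewrite mulSnr big_split_ord /= big_ord_recr /=; congr (_ + _).
exact: IHq.
Qed.

Lemma ones_slabs q w r n A :
  ones n (q * w + r) A
    = \sum_(s < q) ones n w (fun x c => A x (s * w + c))
      + ones n r (fun x c => A x (q * w + c)).
Proof.
rewrite /ones [X in _ = X + _]exchange_big -big_split /=; apply: eq_bigr => x _.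
by rewrite (big_ord_slabs q w r (A x)).
Qed.

(** In a global row, the last entries of the slabs exceed the contracted row by at most one, for the
    dropped first slab; the first entry of the final slab costs one more. Each column pays for two
    extremal entries. *)
Lemma leq_ones_global q w m n A : m <= q * w -> 0 < w -> zigzag_free A ->
  ones n m (fun x c => A x c && global q w m A x)
    <= ones n q (contract w m A) + 2 * \sum_(x < n) global q w m A x + 2 * m.
Proof.
move=> le_m w_gt0 freeA; set G := global q w m A.
have slab_lt (c : 'I_m) : c %/ w < q.
  by rewrite ltn_divLR //; apply: leq_trans le_m.
(* An entry that is not last in its slab, and whose row continues in a later
   slab, is the lowest such entry of its column.  In the last slab of its row,
   an entry which is neither first nor last is the highest such entry. *)
pose af x (c : 'I_m) := after_slab w m A x (c %/ w).
pose lastin (x : 'I_n) (c : 'I_m) := [&& A x c, G x &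
  [forall c' : 'I_m, (c < c') && (c' %/ w == c %/ w) ==> ~~ A x c']].
pose firstin (x : 'I_n) (c : 'I_m) := [&& A x c, G x, ~~ af x c &
  [forall c' : 'I_m, (c' < c) && (c' %/ w == c %/ w) ==> ~~ A x c']].
pose bot (x : 'I_n) (c : 'I_m) := [&& A x c, af x c &
  [forall y : 'I_n, (x < y) ==> ~~ (A y c && af y c)]].
pose top (x : 'I_n) (c : 'I_m) := [&& A x c, G x, ~~ af x c &
  [forall y : 'I_n, (y < x) ==> ~~ [&& A y c, G y & ~~ af y c]]].
have cover (x : 'I_n) (c : 'I_m) :
    A x c && G x <= lastin x c + firstin x c + (bot x c + top x c).
  case Axc: (A x c) => //; case Gx: (G x) => //=.
  (* A global row meets two slabs, so it has an entry before its final slab. *)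
  have bef y : G y -> A y c -> ~~ af y c ->
      exists2 c0 : 'I_m, A y c0 & c0 %/ w < c %/ w.
    case/existsP=> s /andP[/existsP[c1 /andP[Ac1 /eqP sc1]]].
    case/existsP=> c0 /andP[Ac0 lt_c0] _ /existsPn/(_ c1).
    rewrite Ac1 sc1 /= -leqNgt => le_s; exists c0 => //.
    exact: leq_trans lt_c0 le_s.
  case: (boolP (lastin x c)) => // /negP not_last.
  have [c2 /andP[lt_c2 /eqP s_c2] Axc2] :
      exists2 c2 : 'I_m, (c < c2) && (c2 %/ w == c %/ w) & A x c2.
    apply/exists_inP; apply: contra_notT not_last => /exists_inPn noc.
    rewrite /lastin Axc Gx /=; apply/forallP=> c'; apply/implyP; exact: noc.
  rewrite add0n; case: (boolP (af x c)) => afx.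
    suff -> : bot x c by rewrite addnCA; exact: leq_addr.
    rewrite /bot Axc afx /=; apply/forallP=> y; apply/implyP=> lt_xy.
    apply/negP=> /andP[Ayc /existsP[c3 /andP[Ac3 lt_c3]]].
    (* A degenerate zigzag with [c0 = c1 = c], which the weak inequality admits. *)
    apply/idP: Ac3; apply: (freeA x y c c c2 c3) => //.
    by apply: (@ltn_div w); rewrite s_c2.
  case: (boolP (firstin x c)) => // /negP not_first.
  have [c1 /andP[lt_c1 /eqP s_c1] Axc1] :
      exists2 c1 : 'I_m, (c1 < c) && (c1 %/ w == c %/ w) & A x c1.
    apply/exists_inP; apply: contra_notT not_first => /exists_inPn noc.
    rewrite /firstin Axc Gx afx /=.
    apply/forallP=> c'; apply/implyP; exact: noc.
  suff -> : top x c by rewrite addnA; exact: leq_addl.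
  rewrite /top Axc Gx afx /=; apply/forallP=> y; apply/implyP=> lt_yx.
  apply/negP=> /and3P[Ayc Gy afy].
  have [c0 Ayc0 lt_c0] := bef y Gy Ayc afy.
  apply/idP: Axc2; apply: (freeA y x c0 c1 c c2) => //.
  by apply/ltnW/(@ltn_div w); rewrite s_c1.
have slab_split (P : pred 'I_m) :
    \sum_(c < m) P c = \sum_(s < q) \sum_(c < m) (P c && (c %/ w == s)).
  rewrite exchange_big /=; apply: eq_bigr => c _.
  rewrite (bigD1 (Ordinal (slab_lt c))) //= eqxx andbT big1 ?addn0 // => s.
  rewrite eq_sym -val_eqE /= => /negPf ->; rewrite andbF //.
have sum_last (x : 'I_n) :
    \sum_(c < m) lastin x c <= \sum_(s < q) contract w m A x s + G x.
  rewrite slab_split.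
  (* The second summand singles out the first slab of the row; that slab is unique, so the sum over
     [s] is at most [G x]. *)
  apply: (@leq_trans (\sum_(s < q) (contract w m A x s
    + (in_slab w m A x s && ~~ before_slab w m A x s && G x)))).
    apply: leq_sum => s _.
    apply: (@leq_trans (in_slab w m A x s && G x)).
      apply: leq_sum_uniq => [c | c c'].
        case/andP=> /and3P[Axc -> _] s_c; rewrite andbT.
        by apply/existsP; exists c; rewrite Axc.
      case/andP=> /and3P[Axc _ /forallP/(_ c') last_c] /eqP s_c.
      case/andP=> /and3P[Axc' _ /forallP/(_ c) last_c'] /eqP s_c'.
      apply/val_inj; move: last_c last_c'.
      by rewrite s_c s_c' eqxx !andbT Axc Axc'; case: ltngtP.
    rewrite /contract; case: (in_slab _ _ _ _ _) => //=.
    by case: (before_slab _ _ _ _ _) => //=; rewrite leq_b1.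
  rewrite big_split leq_add2l.
  apply: leq_sum_uniq => [s /andP[] // | s s'].
  case/andP=> /andP[/existsP[c /andP[Axc s_c]] nb_s] _.
  case/andP=> /andP[/existsP[c' /andP[Axc' s_c']] nb_s'] _.
  move/existsPn: nb_s => /(_ c'); rewrite Axc' (eqP s_c') /= -leqNgt => le_s.
  move/existsPn: nb_s' => /(_ c); rewrite Axc (eqP s_c) /= -leqNgt => le_s'.
  by apply/val_inj/eqP; rewrite eqn_leq le_s le_s'.
have sum_first (x : 'I_n) : \sum_(c < m) firstin x c <= G x.
  apply: leq_sum_uniq => [c /and4P[] // | c c'].
  case/and4P=> Axc _ /existsPn/(_ c') af_c /forallP/(_ c') first_c.
  case/and4P=> Axc' _ /existsPn/(_ c) af_c' /forallP/(_ c) first_c'.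
  move: af_c af_c' first_c first_c'; rewrite Axc Axc' /= -!leqNgt => le1 le2.
  have -> : c %/ w = c' %/ w by apply/eqP; rewrite eqn_leq le1 le2.
  rewrite eqxx !andbT !implybF -!leqNgt => le3 le4.
  by apply/val_inj/eqP; rewrite eqn_leq le3 le4.
have sum_bot (c : 'I_m) : \sum_(x < n) bot x c <= 1.
  apply: (@leq_sum_uniq _ _ true) => // x y.
  case/and3P=> Ax afx /forallP/(_ y) bx /and3P[Ay afy /forallP/(_ x) by_].
  by apply/val_inj; move: bx by_; rewrite Ax Ay afx afy; case: ltngtP.
have sum_top (c : 'I_m) : \sum_(x < n) top x c <= 1.
  apply: (@leq_sum_uniq _ _ true) => // x y.
  case/and4P=> Ax Gx afx /forallP/(_ y) bx.
  case/and4P=> Ay Gy afy /forallP/(_ x) by_.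
  by apply/val_inj; move: bx by_; rewrite Ax Ay Gx Gy afx afy; case: ltngtP.
apply: (@leq_trans (\sum_(x < n) (\sum_(c < m) lastin x c
    + \sum_(c < m) firstin x c)
  + \sum_(c < m) (\sum_(x < n) bot x c + \sum_(x < n) top x c))).
  rewrite [X in _ + X]big_split /= ![\sum_(c < m) \sum_(x < n) _]exchange_big.
  rewrite -!big_split /=; apply: leq_sum => x _.
  by rewrite -!big_split; apply: leq_sum => c _; apply: cover.
apply: leq_add.
  rewrite mul2n -addnn addnA -!big_split; apply: leq_sum => x _.
  exact: leq_add.
apply: (@leq_trans (\sum_(c < m) 2)).
  by apply: leq_sum => c _; rewrite -[2]/(1 + 1); apply: leq_add.
by rewrite sum_nat_const card_ord mulnC.
Qed.

Lemma zigzag_free_mask m n A (P : pred nat) : zigzag_free A ->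
  zigzag_free (fun x c => [&& A x c, c < m, x < n & P x]).
Proof.
move=> freeA x y c0 c1 c2 c3 lt_xy le01 lt12 lt23 /andP[A0 _] /andP[A1 _].
by case/andP=> A2 _; rewrite negb_and (freeA _ _ _ _ _ _ lt_xy le01 lt12 lt23).
Qed.

Lemma zigzag_free_shift a A :
  zigzag_free A -> zigzag_free (fun x c => A x (a + c)).
Proof.
move=> freeA x y c0 c1 c2 c3 lt_xy le01 lt12 lt23.
by apply: freeA; rewrite ?leq_add2l ?ltn_add2l.
Qed.

(** A local row has entries in at most one slab, so the row terms of the slabs add up without
    counting a row twice. *)
Lemma leq_ones_local q w r p e n m A :
  m = q * w + r -> 0 < r <= w ->
  (forall v, v <= w -> zigzag_bound p e n v) -> zigzag_free A ->
  ones n m (fun x c => A x c && ~~ global q.+1 w m A x)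
    <= p * \sum_(x < n) ([exists c : 'I_m, A x c] && ~~ global q.+1 w m A x)
       + e * (m - q.+1).
Proof.
move=> def_m /andP[r_gt0 le_rw] bnd freeA.
have w_gt0 : 0 < w by apply: leq_trans le_rw.
pose L x c := [&& A x c, c < m, x < n & ~~ global q.+1 w m A x].
have freeL : zigzag_free L.
  exact: (zigzag_free_mask _ _ _ (fun x => ~~ global q.+1 w m A x)).
pose lrows s := \sum_(x < n) [exists c : 'I_m, L x c && (c %/ w == s)].
have bnd_slab s v : v <= w -> s * w + v <= m ->
    ones n v (fun x c => L x (s * w + c)) <= p * lrows s + e * (v - 1).
  move=> le_vw le_vm; have freeLs := zigzag_free_shift (s * w) _ freeL.
  apply: leq_trans (bnd v le_vw _ freeLs) _.
  rewrite leq_add2r leq_mul2l; apply/orP; right; apply: leq_sum => x _.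
  case: existsP => // -[c Lc].
  suff -> : [exists c : 'I_m, L x c && (c %/ w == s)] by [].
  have lt_c : s * w + c < m by apply: leq_trans le_vm; rewrite ltn_add2l.
  apply/existsP; exists (Ordinal lt_c); rewrite Lc /= divnMDl //.
  by rewrite divn_small ?addn0 ?eqxx //; apply: leq_trans le_vw.
have -> : ones n m (fun x c => A x c && ~~ global q.+1 w m A x) = ones n m L.
  apply: eq_bigr => x _; apply: eq_bigr => c _.
  by rewrite /L !ltn_ord.
rewrite [in ones n m L]def_m ones_slabs.
have le_rows :
    \sum_(s < q.+1) lrows s
      <= \sum_(x < n) ([exists c : 'I_m, A x c] && ~~ global q.+1 w m A x).
  rewrite exchange_big /=; apply: leq_sum => x _.
  have lt_q (c : 'I_m) : c %/ w < q.+1.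
    rewrite ltn_divLR // mulSnr; apply: leq_trans (ltn_ord c) _.
    by rewrite def_m leq_add2l.
  apply: leq_sum_uniq => [s | s s'].
    case/existsP=> c /andP[/and4P[Axc _ _ ->] _]; rewrite andbT.
    by apply/existsP; exists c.
  case/existsP=> c /andP[/and4P[Axc _ _ loc] s_c].
  case/existsP=> c' /andP[/and4P[Axc' _ _ _] s_c'].
  apply/val_inj; case: (ltngtP s s') => // lt_s; case/negP: loc.
    apply/existsP; exists s'; apply/andP; split; apply/existsP.
      by exists c'; rewrite Axc'.
    by exists c; rewrite Axc (eqP s_c).
  apply/existsP; exists s; apply/andP; split; apply/existsP.
    by exists c; rewrite Axc.
  by exists c'; rewrite Axc' (eqP s_c').
apply: (@leq_trans (p * \sum_(s < q.+1) lrows s + e * (m - q.+1))); last first.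
  by rewrite leq_add2r leq_mul2l le_rows orbT.
(* Each of the [q.+1] nonempty slabs saves one column. *)
have -> : m - q.+1 = q * (w - 1) + (r - 1) by rewrite def_m; nia.
rewrite big_ord_recr /= !mulnDr addnACA; apply: leq_add; last first.
  by apply: bnd_slab; rewrite // def_m.
rewrite big_distrr /= mulnCA -[q in q * _]card_ord -sum_nat_const -big_split.
apply: leq_sum => s _; apply: bnd_slab => //.
rewrite def_m -mulSnr; apply: leq_trans (leq_addr _ _).
by rewrite leq_mul2r ltn_ord orbT.
Qed.

(** Local rows pay [p.+2] inside their slab; global rows pay [p] in the contraction and 2 for what
    it loses. One row coefficient thus serves both. *)
Lemma zigzag_bound_step q w r p e d n m :
  m = q * w + r -> 0 < r <= w ->
  (forall v, v <= w -> zigzag_bound p.+2 e n v) ->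
  zigzag_bound p d n q.+1 ->
  forall A, zigzag_free A ->
  ones n m A <= p.+2 * nzrows n m A + e * (m - q.+1) + d * q + 2 * m.
Proof.
move=> def_m r_bnd loc glob A freeA.
have [r_gt0 le_rw] := andP r_bnd.
have w_gt0 : 0 < w by apply: leq_trans le_rw.
have le_m : m <= q.+1 * w by rewrite def_m mulSnr leq_add2l.
set G := global q.+1 w m A.
have split_ones : ones n m A = ones n m (fun x c => A x c && ~~ G x)
                               + ones n m (fun x c => A x c && G x).
  rewrite /ones -big_split; apply: eq_bigr => x _.
  rewrite -big_split; apply: eq_bigr => c _ /=.
  by case: (A x c); case: (G x).
set NL := \sum_(x < n) ([exists c : 'I_m, A x c] && ~~ G x).
have split_rows : nzrows n m A = NL + \sum_(x < n) G x.
  rewrite /NL -big_split; apply: eq_bigr => x _ /=.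
  case Gx: (G x); rewrite ?andbT ?addn0 // andbF add0n.
  case/existsP: Gx => s /andP[/existsP[c /andP[Axc _]] _].
  by suff -> : [exists c : 'I_m, A x c] by []; apply/existsP; exists c.
have := leq_ones_local _ _ _ _ _ n _ A def_m r_bnd loc freeA.
have := leq_ones_global _ _ _ n A le_m w_gt0 freeA.
have := glob _ (zigzag_free_contract w m A freeA).
have -> : nzrows n q.+1 (contract w m A) = \sum_(x < n) G x by [].
rewrite -/G -/NL split_ones split_rows subn1 /= mulnDr.
set g := \sum_(x < n) G x; have -> : p.+2 * g = p * g + 2 * g by lia.
move: (ones n q.+1 _) (ones n m _) (ones n m _) => C X Y.
move: (p.+2 * NL) (p * g) (d * q) (e * _) => a b f h.
by move: (g); clear; lia.
Qed.

(** * The recursion along the Ackermann table *)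

Lemma zigzag_bound_trivial p n m : m <= p -> zigzag_bound p 0 n m.
Proof.
move=> le_mp A _; apply: leq_trans (ones_trivial _ _ _) _.
by rewrite addn0 leq_mul2r le_mp orbT.
Qed.

Lemma zigzag_bound_weaken p p' e e' n m :
  p <= p' -> e <= e' -> zigzag_bound p e n m -> zigzag_bound p' e' n m.
Proof.
by move=> le_p le_e bnd A /bnd/leq_trans -> //; rewrite leq_add ?leq_mul.
Qed.

(** Dividing [m.-1] instead of [m] keeps the last slab nonempty even when [w] divides [m]. *)
Lemma divn_pred_split w m : 0 < w -> 0 < m ->
  exists2 r, 0 < r <= w & m = (m.-1 %/ w) * w + r.
Proof.
move=> w_gt0 m_gt0; exists (m.-1 %% w).+1; first by rewrite ltn_pmod.
by rewrite addnS -divn_eq prednK.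
Qed.

(** Reading row 0 of the table as the constant 2 makes the doubling in row 1 an instance of the
    general recurrence. *)
Lemma ackSl i j : ack i.+1 j.+2
  = ack i.+1 j.+1 * (if i is 0 then 2 else ack i (ack i.+1 j.+1)).
Proof. by case: i => [|i]; rewrite ?ackSS // !ack1 expnSr. Qed.

(** Raising [j] by one supplies [2 * i.+1 * (m - 1)], which absorbs [z + 2 * m] up to an excess of
    2. The [q] columns saved by the slabs cover that excess. *)
Lemma zigzag_bound_arith i j m q z :
  0 < q < m -> z <= 2 * i * (m - 1) ->
  2 * i.+1 * j.+1 * (m - q.+1) + (z + 2 * m) <= 2 * i.+1 * j.+2 * (m - 1).
Proof.
case/andP=> q_gt0 lt_qm; have -> : m = (m - q.+1) + q + 1 by lia.
move: (m - q.+1) => d le_z; have -> : d + q + 1 - q.+1 = d by lia.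
rewrite addnK in le_z *.
have : 0 < i.+1 * j.+1 * q by rewrite !muln_gt0.
move: le_z; nia.
Qed.

(** Double induction: slabs of width [w = ack i.+1 j.+1] fall under the hypothesis on [j]. There are
    at most [ack i w] of them (2 if [i = 0]), so the contraction falls under the hypothesis on [i],
    used at column [w]. *)
Lemma zigzag_bound_ack n i j m :
  m <= (if i is 0 then 2 else ack i j.+1) ->
  zigzag_bound (2 * i + 2) (2 * i * j.+1) n m.
Proof.
elim: i j m => [|i IHi] j m le_m.
  by rewrite muln0; apply: zigzag_bound_trivial.
elim: j m le_m => [|j IHj] m le_m.
  have {}le_m : m <= 2 by apply: leq_trans le_m _; case: (i).
  apply: (@zigzag_bound_weaken 2 _ 0) => //; first by lia.
  exact: zigzag_bound_trivial.
have [le_mw | lt_wm] := leqP m (ack i.+1 j.+1).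
  apply: zigzag_bound_weaken (IHj _ le_mw) => //.
  by rewrite leq_mul2l ltnW ?orbT // ltnS.
have w_gt0 := ack_gt0 i j; move: le_m; rewrite ackSl.
set w := ack i.+1 j.+1 in IHj lt_wm w_gt0 *; move=> le_m.
have m_gt0 : 0 < m by apply: leq_trans lt_wm.
have [r r_bnd def_m] := divn_pred_split w m w_gt0 m_gt0.
set q := m.-1 %/ w in def_m.
have q_gt0 : 0 < q by rewrite divn_gt0 // -ltnS prednK.
have le_q : q.+1 <= (if i is 0 then 2 else ack i w).
  by rewrite ltn_divLR // prednK // mulnC.
have glob : zigzag_bound (2 * i + 2) (2 * i * w) n q.+1.
  by have := IHi w.-1 q.+1; rewrite prednK //; apply.
move=> A freeA.
have [r_gt0 le_rw] := andP r_bnd.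
have loc v : v <= w -> zigzag_bound (2 * i + 2).+2 (2 * i.+1 * j.+1) n v.
  by move=> le_v; apply: zigzag_bound_weaken (IHj _ le_v); lia.
have step := zigzag_bound_step _ _ _ _ _ _ _ _ def_m r_bnd loc glob A freeA.
apply: leq_trans step _.
have -> : 2 * i.+1 + 2 = (2 * i + 2).+2 by lia.
rewrite -addnA -addnA; apply: (leq_add (leqnn _)).
(* The factor [w] in the cost of the contraction cancels against the number of slabs. *)
have le1 : 2 * i * w * q <= 2 * i * (m - 1).
  by rewrite -mulnA leq_mul2l; apply/orP; right; rewrite mulnC; lia.
by apply: zigzag_bound_arith => //; rewrite q_gt0 /=; nia.
Qed.

(** * Zigzag-free square matrices and [alpha] *)

Lemma alphaP n : 0 < n -> 0 < alpha n /\ n <= ack (alpha n) 3.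
Proof.
move=> n_gt0; rewrite /alpha /alpha2; case: ex_minnP => i /andP[i_gt0 le_n] _.
(* For a square matrix the ceiling is 1, so the table is always read in column 3. *)
split=> //; suff <- : maxn 3 (ceil_div n n) = 3 by [].
apply/maxn_idPl; rewrite /ceil_div divnDl // divnn n_gt0.
by rewrite divn_small // prednK.
Qed.

(** Used directly, the previous bound costs about [6 * n * alpha n] for columns. Slabs of width
    [alpha n] need no column term, and their contraction is narrow enough to cost only [6 * n]. The
    constant is 12 = 4 + 6 + 2: rows, contraction, extremal entries. *)
Lemma leq_ones_alpha n A : 0 < n -> zigzag_free A ->
  ones n n A <= 2 * n * alpha n + 12 * n.
Proof.
move=> n_gt0 freeA; have [a_gt0 le_n] := alphaP n n_gt0.
set a := alpha n in a_gt0 le_n *.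
have [r r_bnd def_n] := divn_pred_split a n a_gt0 n_gt0.
set q := n.-1 %/ a in def_n.
have glob : zigzag_bound (2 * a + 2) (2 * a * 3) n q.+1.
  apply: (zigzag_bound_ack n a 2); case: (a) a_gt0 le_n => // a' _ le_n.
  apply: leq_trans le_n; rewrite -[leqRHS](prednK n_gt0) ltnS; exact: leq_div.
have := zigzag_bound_step q a r (2 * a + 2) 0 (2 * a * 3) n n
  def_n r_bnd _ glob A freeA.
move=> /(_ _)/leq_trans; apply.
  move=> m le_m; apply: (@zigzag_bound_weaken m _ 0) => //; first by lia.
  exact: zigzag_bound_trivial.
have le1 : (2 * a + 2).+2 * nzrows n n A <= (2 * a + 2).+2 * n.
  by rewrite leq_mul2l leq_nzrows orbT.
have le2 : 2 * a * 3 * q <= 6 * n by rewrite def_n; nia.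
move: le1 le2; set X := _ * nzrows _ _ _; nia.
Qed.

(** * Matrices avoiding H *)

Lemma leq_ones_H_free n m (A : nat -> nat -> bool) :
  (forall x y c1 c2 c3, x < y -> c1 < c2 -> c2 < c3 ->
     A y c1 -> A x c2 -> ~~ A y c3) ->
  ones n m A <= 2 * n + m.
Proof.
move=> freeA.
pose first (x : 'I_n) (c : 'I_m) :=
  A x c && [forall c' : 'I_m, (c' < c) ==> ~~ A x c'].
pose last (x : 'I_n) (c : 'I_m) :=
  A x c && [forall c' : 'I_m, (c < c') ==> ~~ A x c'].
pose top (x : 'I_n) (c : 'I_m) :=
  A x c && [forall y : 'I_n, (y < x) ==> ~~ A y c].
(* Otherwise an entry above and one on each side form a copy of H. *)
have cover (x : 'I_n) (c : 'I_m) : A x c <= first x c + last x c + top x c.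
  rewrite /first /last /top; case Axc: (A x c) => //=.
  case: (boolP [forall _, _]) => // /forallPn[c1].
  rewrite negb_imply negbK => /andP[lt_c1 Ac1].
  case: (boolP [forall _, _]) => // /forallPn[c3].
  rewrite negb_imply negbK => /andP[lt_c3 Ac3].
  case: (boolP [forall _, _]) => // /forallPn[y].
  rewrite negb_imply negbK => /andP[lt_y Ay].
  by case/negP: (freeA y x c1 c c3 lt_y lt_c1 lt_c3 Ac1 Ay).
have sum_first (x : 'I_n) : \sum_(c < m) first x c <= 1.
  apply: (@leq_sum_uniq _ _ true) => // c c'.
  case/andP=> Ac /forallP/(_ c') + /andP[Ac' /forallP/(_ c)].
  by rewrite Ac Ac'; case: ltngtP => // /val_inj.
have sum_last (x : 'I_n) : \sum_(c < m) last x c <= 1.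
  apply: (@leq_sum_uniq _ _ true) => // c c'.
  case/andP=> Ac /forallP/(_ c') + /andP[Ac' /forallP/(_ c)].
  by rewrite Ac Ac'; case: ltngtP => // /val_inj.
have sum_top (c : 'I_m) : \sum_(x < n) top x c <= 1.
  apply: (@leq_sum_uniq _ _ true) => // x y.
  case/andP=> Ax /forallP/(_ y) + /andP[Ay /forallP/(_ x)].
  by rewrite Ax Ay; case: ltngtP => // /val_inj.
apply: (@leq_trans (\sum_(x < n) (\sum_(c < m) first x c
    + \sum_(c < m) last x c) + \sum_(c < m) \sum_(x < n) top x c)).
  rewrite [X in _ + X]exchange_big -!big_split /=; apply: leq_sum => x _.
  by rewrite -!big_split; apply: leq_sum => c _; apply: cover.
apply: leq_add.
  apply: (@leq_trans (\sum_(x < n) 2)).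
    by apply: leq_sum => x _; rewrite -[2]/(1 + 1); apply: leq_add.
  by rewrite sum_nat_const card_ord mulnC.
apply: (@leq_trans (\sum_(c < m) 1)); first exact: leq_sum.
by rewrite sum_nat_const card_ord muln1.
Qed.

(** * Chains of copies of H *)

(** Containment of I_t (x) H in the rows before [i] and columns before [j]. The recursion peels off
    the lower right copy; the remaining ones lie strictly above and to the left of its corner
    [(r1, c1)]. *)
Fixpoint H_chain (A : nat -> nat -> bool) (t i j : nat) : bool :=
  if t is t'.+1 then
    [exists r1 : 'I_i, exists r2 : 'I_i,
     exists c1 : 'I_j, exists c2 : 'I_j, exists c3 : 'I_j,
     [&& r1 < r2, c1 < c2, c2 < c3, A r1 c2, A r2 c1, A r2 c3
       & H_chain A t' r1 c1]]
  else true.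

Lemma H_chainSP (A : nat -> nat -> bool) t i j :
  reflect (exists r1 r2 c1 c2 c3, [/\ r1 < r2 < i, [&& c1 < c2, c2 < c3 & c3 < j],
             [/\ A r1 c2, A r2 c1 & A r2 c3] & H_chain A t r1 c1])
    (H_chain A t.+1 i j).
Proof.
apply: (iffP existsP) => [[r1 /existsP[r2 /existsP[c1 /existsP[c2 /existsP[c3]]]]]|].
  case/and5P=> ltr lt1 lt2 A1 /and3P[A2 A3 ch].
  by exists r1, r2, c1, c2, c3; rewrite ltr lt1 lt2 !ltn_ord.
case=> r1 [r2 [c1 [c2 [c3 [/andP[ltr ltr2] /and3P[lt1 lt2 lt3] [A1 A2 A3] ch]]]]].
have lt2j := ltn_trans lt2 lt3; exists (Ordinal (ltn_trans ltr ltr2)).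
apply/existsP; exists (Ordinal ltr2).
apply/existsP; exists (Ordinal (ltn_trans lt1 lt2j)).
apply/existsP; exists (Ordinal lt2j).
by apply/existsP; exists (Ordinal lt3); apply/and5P; split=> //; apply/and3P.
Qed.

Lemma H_chain_mono A t i j i' j' :
  i <= i' -> j <= j' -> H_chain A t i j -> H_chain A t i' j'.
Proof.
case: t => // t le_i le_j /H_chainSP[r1 [r2 [c1 [c2 [c3 []]]]]].
case/andP=> ltr ltr2 /and3P[lt1 lt2 lt3] As ch; apply/H_chainSP.
exists r1, r2, c1, c2, c3; split=> //; first by rewrite ltr (leq_trans ltr2).
by rewrite lt1 lt2 (leq_trans lt3).
Qed.

(** Glues the nested witnesses into two increasing index functions, numbered as in the Kronecker
    product. The peeled copy takes the last two rows and three columns. *)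
Lemma H_chain_indices (A : nat -> nat -> bool) t i j : H_chain A t i j ->
  exists r c : nat -> nat,
    [/\ forall u v, u < v < t * 2 -> r u < r v,
        forall u, u < t * 2 -> r u < i,
        forall u v, u < v < t * 3 -> c u < c v,
        forall u, u < t * 3 -> c u < j &
        forall s, s < t -> [/\ A (r (s * 2)) (c (s * 3 + 1)),
          A (r (s * 2 + 1)) (c (s * 3)) & A (r (s * 2 + 1)) (c (s * 3 + 2))]].
Proof.
elim: t i j => [|t IHt] i j.
  by exists id, id; split=> // u v; rewrite ltn0 andbF.
case/H_chainSP=> r1 [r2 [c1 [c2 [c3 []]]]].
case/andP=> ltr ltr2 /and3P[lt1 lt2 lt3] [A1 A2 A3] /IHt.
case=> r [c [r_incr r_lt c_incr c_lt rcA]].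
exists (fun u => if u < t * 2 then r u else if u == t * 2 then r1 else r2).
exists (fun u => if u < t * 3 then c u else
                 if u == t * 3 then c1 else if u == t * 3 + 1 then c2 else c3).
split.
- move=> u v; case: (ltnP u (t * 2)) => le_u; case: (ltnP v (t * 2)) => le_v.
  + by case/andP=> lt_uv _; apply: r_incr; rewrite lt_uv.
  + by move=> _; have := r_lt u le_u; case: eqP; lia.
  + by lia.
  + by case: (u =P t * 2); case: (v =P t * 2); lia.
- move=> u lt_u; case: (ltnP u (t * 2)) => le_u; last by case: eqP; lia.
  by have := r_lt u le_u; lia.
- move=> u v; case: (ltnP u (t * 3)) => le_u; case: (ltnP v (t * 3)) => le_v.
  + by move=> /andP[lt_uv _]; apply: c_incr; rewrite lt_uv.
  + by move=> _; have := c_lt u le_u; case: eqP => _; last case: eqP; lia.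
  + by lia.
  + case: (u =P t * 3) => u0; case: (v =P t * 3) => v0;
    case: (u =P t * 3 + 1) => u1; case: (v =P t * 3 + 1) => v1; lia.
- move=> u lt_u; case: (ltnP u (t * 3)) => le_u.
    by have := c_lt u le_u; lia.
  by case: eqP => _; last case: eqP; lia.
move=> s; rewrite ltnS leq_eqVlt => /predU1P[-> | lt_s].
  rewrite !ltnn !eqxx.
  have -> : (t * 2 + 1 < t * 2) = false by lia.
  have -> : (t * 3 + 1 < t * 3) = false by lia.
  have -> : (t * 3 + 2 < t * 3) = false by lia.
  have -> : (t * 2 + 1 == t * 2) = false by lia.
  have -> : (t * 3 + 1 == t * 3) = false by lia.
  have -> : (t * 3 + 2 == t * 3) = false by lia.
  by have -> : (t * 3 + 2 == t * 3 + 1) = false by lia.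
have -> : s * 2 < t * 2 by lia.
have -> : s * 2 + 1 < t * 2 by lia.
have -> : s * 3 < t * 3 by lia.
have -> : s * 3 + 1 < t * 3 by lia.
have -> : s * 3 + 2 < t * 3 by lia.
exact: rcA.
Qed.

(** Extension by zero, which allows natural number indices and shifts. *)
Definition mx_fun {n} (A : 'M[bool]_n) (i j : nat) : bool :=
  [exists x : 'I_n, exists y : 'I_n, [&& x == i :> nat, y == j :> nat & A x y]].

Lemma mx_funE n (A : 'M[bool]_n) (x y : 'I_n) : mx_fun A x y = A x y.
Proof.
apply/existsP/idP => [[x' /existsP[y' /and3P[]]] | Axy].
  by move=> /eqP/val_inj -> /eqP/val_inj ->.
by exists x; apply/existsP; exists y; rewrite !eqxx.
Qed.

Lemma H_chain_contains k n (A : 'M[bool]_n) : H_chain (mx_fun A) k n n ->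
  contains ((1%:M : 'M[bool]_k)%R *t H) A.
Proof.
case/H_chain_indices=> r [c [r_incr r_lt c_incr c_lt rcA]].
apply/existsP; exists [ffun u : 'I_(k * 2) => Ordinal (r_lt u (ltn_ord u))].
apply/existsP; exists [ffun u : 'I_(k * 3) => Ordinal (c_lt u (ltn_ord u))].
apply/and3P; split.
- apply/forallP=> u; apply/forallP=> v; apply/implyP=> lt_uv.
  by rewrite !ffunE /= r_incr // lt_uv ltn_ord.
- apply/forallP=> u; apply/forallP=> v; apply/implyP=> lt_uv.
  by rewrite !ffunE /= c_incr // lt_uv ltn_ord.
apply/forallP=> u; apply/forallP=> v; apply/implyP.
case: (mxtens_indexP u) => s b; case: (mxtens_indexP v) => s' b'.
rewrite tensmxE !ffunE !mxE -mx_funE /=.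
case: eqP => [<- | _] //; have [A1 A2 A3] := rcA s (ltn_ord s).
case: b => [[|[|//]] ? /=]; case: b' => [[|[|[|//]]] ? /=] //;
  by rewrite ?addn0.
Qed.

Lemma weightE n (A : 'M[bool]_n) : weight A = ones n n (mx_fun A).
Proof.
rewrite /weight cardsE -sum1_card big_mkcond /= -(pair_big predT predT
  (fun x c => if A x c then 1 else 0)) /=.
apply: eq_bigr => x _; apply: eq_bigr => c _; rewrite mx_funE.
by case: (A x c).
Qed.

(** * Levels and the final count *)

Lemma leq_ones_diag n m (A : nat -> nat -> bool) :
  (forall x c d, 0 < d -> A x c -> ~~ A (x + d) (c + d)) ->
  ones n m A <= n + m.
Proof.
move=> diagA; rewrite /ones pair_big /=.
(* [p.1 + (m - p.2.+1)] numbers the diagonals, shifted to stay nonnegative. *)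
have -> : \sum_(p : 'I_n * 'I_m) A p.1 p.2 =
    \sum_(d < n + m) \sum_(p : 'I_n * 'I_m) (A p.1 p.2 && (p.1 + (m - p.2.+1) == d)).
  rewrite exchange_big /=; apply: eq_bigr => p _.
  have lt_p : p.1 + (m - p.2.+1) < n + m.
    by have := ltn_ord p.1; have := ltn_ord p.2; lia.
  rewrite (bigD1 (Ordinal lt_p)) //= eqxx andbT big1 ?addn0 // => d.
  by rewrite eq_sym -val_eqE /= => /negPf ->; rewrite andbF.
rewrite -[leqRHS]card_ord -sum1_card; apply: leq_sum => d _.
apply: (@leq_sum_uniq _ _ true) => // -[x c] [x' c'] /=.
case/andP=> Axc /eqP eq_d /andP[Axc' /eqP eq_d'].
have := ltn_ord c; have := ltn_ord c'; move=> lt_c' lt_c.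
have E (u u' : 'I_n) (v v' : 'I_m) : u + (m - v.+1) = u' + (m - v'.+1) ->
    v < m -> v' < m -> u < u' -> A u v -> ~~ A u' v'.
  move=> eq_uv lt_v lt_v' lt_u.
  have -> : A u' v' = A (u + (u' - u)) (v + (u' - u)) by congr (A _ _); lia.
  by apply: diagA; rewrite subn_gt0.
case: (ltngtP x x') => [lt_x | lt_x | eq_x].
- by case/negP: (E x x' c c' (etrans eq_d (esym eq_d')) lt_c lt_c' lt_x Axc).
- by case/negP: (E x' x c' c (etrans eq_d' (esym eq_d)) lt_c' lt_c lt_x Axc').
- have eq_c : c = c' :> nat by lia.
  by congr (_, _); apply: val_inj.
Qed.

Lemma leq_ones_level (A : nat -> nat -> bool) t n : 0 < n ->
  ones n n (fun x c => [&& A x c, H_chain A t x c & ~~ H_chain A t.+1 x c])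
    <= (if t is 0 then 5 * n else 2 * n * alpha n + 14 * n).
Proof.
move=> n_gt0.
(* Chains use strictly earlier rows and columns, so a copy of H ending at a cell is first seen from
   its diagonal successor. [D] collects the cells lost by testing there; by monotonicity each
   diagonal has at most one. *)
pose B x c := [&& A x c, H_chain A t x c & ~~ H_chain A t.+1 x.+1 c.+1].
pose D x c := ~~ H_chain A t.+1 x c && H_chain A t.+1 x.+1 c.+1.
have le_D : ones n n D <= n + n.
  apply: leq_ones_diag => x c d d_gt0 /andP[_ ch]; apply/negP=> /andP[/negP[]].
  by apply: H_chain_mono ch; lia.
have le_BD : ones n n (fun x c =>
    [&& A x c, H_chain A t x c & ~~ H_chain A t.+1 x c])
    <= ones n n B + ones n n D.
  rewrite /ones -big_split; apply: leq_sum => x _.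
  rewrite -big_split; apply: leq_sum => c _; rewrite /B /D.
  by case: (A x c); case: (H_chain A t x c);
    case: (H_chain A t.+1 x c); case: (H_chain A t.+1 x.+1 c.+1).
apply: leq_trans le_BD _.
have no_H x y c1 c2 c3 : x < y -> c1 < c2 -> c2 < c3 -> H_chain A t x c1 ->
    A x c2 -> A y c1 -> A y c3 -> H_chain A t.+1 y.+1 c3.+1.
  move=> lt_xy lt1 lt2 ch A1 A2 A3; apply/H_chainSP.
  by exists x, y, c1, c2, c3; rewrite lt_xy lt1 lt2 !ltnSn.
(* At level 0 the chain condition is void, so [B] avoids H: 3n + 2n. At higher levels the entry in
   column [c0] supplies the chain at [(x, c1)], so [B] is zigzag-free and the linear part is 12n +
   2n. *)
case: t => [|t] in B D le_D no_H *.
  have le_B : ones n n B <= 2 * n + n.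
    apply: leq_ones_H_free => x y c1 c2 c3 lt_xy lt1 lt2 /andP[A1 _] /andP[A2 _].
    apply/negP=> /and3P[A3 _ /negP[]].
    exact: (no_H x y c1 c2 c3).
  by apply: leq_trans (leq_add le_B le_D) _; lia.
have freeB : zigzag_free B.
  move=> x y c0 c1 c2 c3 lt_xy le01 lt12 lt23 /and3P[_ ch _] /andP[A1 _].
  case/andP=> A2 _; apply/negP=> /and3P[A3 _ /negP[]].
  apply: (no_H x y c1 c2 c3) => //.
  exact: H_chain_mono ch.
have le_B := leq_ones_alpha n B n_gt0 freeB.
by apply: leq_trans (leq_add le_B le_D) _; lia.
Qed.

Theorem theorem5 :
  exists K : nat, forall k n : nat, 1 <= k -> 1 <= n ->
    Ex ((1%:M : 'M[bool]_k)%R *t H) n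
      <= 2 * (k - 1) * n * alpha n + K * k * n.
Proof.
exists 14 => k n k_gt0 n_gt0; apply/bigmax_leqP => A avoidA.
rewrite weightE; set a := mx_fun A.
have no_chain : ~~ H_chain a k n n by apply: contra avoidA; apply: H_chain_contains.
apply: (@leq_trans (\sum_(t < k) ones n n (fun x c =>
    [&& a x c, H_chain a t x c & ~~ H_chain a t.+1 x c]))).
  rewrite /ones [leqRHS]exchange_big; apply: leq_sum => x _ /=.
  rewrite [leqRHS]exchange_big; apply: leq_sum => c _ /=.
  case: (a x c) => //=.
  have : ~~ H_chain a k x c.
    by apply: contra no_chain; apply: H_chain_mono; apply: ltnW.
  (* Descends to the largest [t] whose chain exists; it is reached because the chain of length 0
     always does. *)
  elim: (k) => [//|k' IHk] no_k; rewrite big_ord_recr /= no_k andbT.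
  case: (boolP (H_chain a k' x c)) => [_ | /IHk le]; first exact: leq_addl.
  exact: leq_trans le (leq_addr _ _).
case: k k_gt0 {avoidA no_chain} => // k _.
rewrite big_ord_recl.
apply: (@leq_trans (5 * n + \sum_(t < k) (2 * n * alpha n + 14 * n))).
  apply: leq_add; first exact: (leq_ones_level a 0 n n_gt0).
  by apply: leq_sum => t _; apply: (leq_ones_level a t.+1 n n_gt0).
rewrite sum_nat_const card_ord subn1 /=; nia.
Qed.
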